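(* Let $k\ge 1$ and let $w$ be an infinite word over the ordered alphabet $A=\{0,1,\ldots,k\}$, $0<1<\cdots<k$, such that every letter of $A$ occurs in $w$. The following statements are equivalent: (1) $w$ is Sturmian over the alphabet $\{0,1\}$. (2) $w$ satisfies the Nice Factors Ordering property (NFOp).
   Context: A factor of $w$ is a finite word occurring as a block of consecutive letters of $w$; $\mathrm{Fact}(w)$ is the set of factors; $A^*$ is the set of finite words over $A$, including the empty word. For finite words, $v<_{\mathrm{lex}}v'$ means $|v|=|v'|$ and there are a word $\lambda$ and letters $a<b$ such that $\lambda a$ is a prefix of $v$ and $\lambda b$ is a prefix of $v'$. For $v,v'\in\mathrm{Fact}(w)$, $v'=\mathrm{succ}_w(v)$ means $v<_{\mathrm{lex}}v'$ and there is no $f\in\mathrm{Fact}(w)$ with $v<_{\mathrm{lex}}f<_{\mathrm{lex}}v'$. NFOp: $w$ (whose set of occurring letters is exactly $A=\{0,\dots,k\}$, $k\ge1$) has the NFOp if one of the following equivalent conditions holds: (i) for every $v,v'\in\mathrm{Fact}(w)$ with $v'=\mathrm{succ}_w(v)$ there exist letters $a<b$ in $A$ and $\lambda,\mu\in A^*$ such that either $v=\lambda ab\mu$ and $v'=\lambda ba\mu$, or $v=\lambda a$ and $v'=\lambda b$; (ii) for every $v,v'\in\mathrm{Fact}(w)$ with $v'=\mathrm{succ}_w(v)$ there exist $m\in A$ and $\lambda,\mu\in A^*$ such that either $v=\lambda m(m+1)\mu$ and $v'=\lambda (m+1)m\mu$, or $v=\lambda m$ and $v'=\lambda(m+1)$;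 (iii) $A=\{0,1\}$ and for every $v,v'\in\mathrm{Fact}(w)$ with $v'=\mathrm{succ}_w(v)$ there exist $\lambda,\mu\in A^*$ such that either $v=\lambda 01\mu$ and $v'=\lambda 10\mu$, or $v=\lambda 0$ and $v'=\lambda 1$. Sturmian: an infinite word over $\{0,1\}$ is Sturmian if it is aperiodic (not ultimately periodic) and balanced (for any two factors $u,u'$ of equal length and each letter $x$, the numbers of occurrences of $x$ in $u$ and in $u'$ differ by at most $1$); equivalently, it has exactly $n+1$ factors of length $n$ for every $n\ge 0$. *)

(* Defs.v *)
From mathcomp Require Import all_boot.
Set Implicit Arguments.
Unset Strict Implicit.
Unset Printing Implicit Defensive.

Section Words.

Variable k : nat.

(* The ordered alphabet {0 < 1 < ... < k}, ordered through the coercion to nat. *)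
Notation A := 'I_k.+1.

Implicit Types (w : nat -> A) (v u f : seq A).

Definition factor w v : Prop :=
  exists i, v = mkseq (fun j => w (i + j)) (size v).

Definition lex_lt v v' : Prop :=
  size v = size v' /\
  exists (lam : seq A) (a b : A),
    [/\ a < b, prefix (rcons lam a) v & prefix (rcons lam b) v'].

Definition is_succ w v v' : Prop :=
  [/\ factor w v, factor w v', lex_lt v v' &
      ~ exists f, [/\ factor w f, lex_lt v f & lex_lt f v']].

Definition NFOp_i w : Prop :=
  forall v v', is_succ w v v' ->
    exists (a b : A) (lam mu : seq A), a < b /\
      ((v = lam ++ [:: a; b] ++ mu /\ v' = lam ++ [:: b; a] ++ mu) \/
       (v = rcons lam a /\ v' = rcons lam b)).

(* The letter m + 1 is the element m1 of the alphabet whose value is m.+1. *)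
Definition NFOp_ii w : Prop :=
  forall v v', is_succ w v v' ->
    exists (m m1 : A) (lam mu : seq A), m1 = m.+1 :> nat /\
      ((v = lam ++ [:: m; m1] ++ mu /\ v' = lam ++ [:: m1; m] ++ mu) \/
       (v = rcons lam m /\ v' = rcons lam m1)).

(* The alphabet is {0, 1} exactly when k = 1, in which case inord 1 has
   value 1. *)
Definition NFOp_iii w : Prop :=
  k = 1 /\
  forall v v', is_succ w v v' ->
    exists lam mu : seq A,
      (v = lam ++ [:: ord0; inord 1] ++ mu /\
       v' = lam ++ [:: inord 1; ord0] ++ mu) \/
      (v = rcons lam ord0 /\ v' = rcons lam (inord 1)).

Definition ultimately_periodic w : Prop :=
  exists N p : nat, 0 < p /\ forall n, N <= n -> w (n + p) = w n.

(* The one-sided bound suffices, as u and u' range over ordered pairs. *)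
Definition balanced w : Prop :=
  forall u u' (x : A), factor w u -> factor w u' -> size u = size u' ->
    count_mem x u <= (count_mem x u').+1.

Definition sturmian w : Prop :=
  [/\ forall n, w n < 2, ~ ultimately_periodic w & balanced w].

End Words.

(* Main.v *)
Require Import Defs.
From mathcomp Require Import all_boot all_order zify.
From Stdlib Require Import Classical ClassicalEpsilon.
Import Order.TTheory.
Set Implicit Arguments.
Unset Strict Implicit.
Unset Printing Implicit Defensive.

(** Suppose [w] is Sturmian, and let [s0u] and [s1u'] be consecutive factors.
Balance makes the number of ones monotone for the lexicographic order.  By
aperiodicity there is a right special factor [r] of every length; if prefixes
of [s0u] and [s1u'] longer than [s0] had different numbers of ones, they would
lie between [r0] and [r1] for some [r], hence share the prefix [r], which is
absurd.  So [u = 1t] and [u' = 0t].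

Conversely, assume NFOp.  If both [sa] and [sb] are factors, with [a < b] and no
letter between them giving a factor, the last factors beginning with [sa] and
the first ones beginning with [sb] are the prefixes of [sabx] and [sbax], for
one infinite word [x].  With [s] empty this bounds the runs of a middle letter
and rules out three letters.  For two letters, [x] does not depend on [s].  If
every factor lies between [0x] and [1x], then [w] is balanced: otherwise some
[0u0] and [1u1] are factors, and [x <= u0 < u1 <= x].  The bound by [1x] holds
because the supremum [M] of the factors extends to the left by [0], so that
[0M <= 01x]; the other bound is its image under complementation. *)

(** Classical truth value, so that extremum searches over finite types and bounded naturals accept
    properties such as being a factor. *)
Definition asb (P : Prop) : bool :=
  if excluded_middle_informative P then true else false.

Lemma asbP (P : Prop) : reflect P (asb P).
Proof. by rewrite /asb; case: excluded_middle_informative => h; constructor. Qed.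

Local Notation "u <=L v" := (@Order.le _ (seqlexi 'I_(_.+1)) u v)
  (at level 70, no associativity).
Local Notation "u <L v" := (@Order.lt _ (seqlexi 'I_(_.+1)) u v)
  (at level 70, no associativity).

(** * Lexicographic order on finite words *)

Section Lex.
Variable k : nat.
Notation A := 'I_k.+1.
Implicit Types (a b : A) (s t u v : seq A).

Lemma lex_cons a b u v :
  (a :: u <=L b :: v) = (a < b) || (a == b) && (u <=L v).
Proof.
rewrite lexi_cons leEord -val_eqE /=.
by case: (ltngtP a b).
Qed.

Lemma lex_cat s u v : (s ++ u <=L s ++ v) = (u <=L v).
Proof. by elim: s => //= a s IH; rewrite lex_cons ltnn eqxx /= IH. Qed.

Lemma lex_refl u : u <=L u. Proof. exact: lexx. Qed.

Lemma lex_trans v u t : u <=L v -> v <=L t -> u <=L t.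
Proof. exact: le_trans. Qed.

Lemma lex_anti u v : u <=L v -> v <=L u -> u = v.
Proof. by move=> h1 h2; apply/eqP; rewrite (@eq_le _ (seqlexi A)) h1 h2. Qed.

Lemma lexNle u v : ~~ (u <=L v) -> v <=L u.
Proof. by rewrite -ltNge => /ltW. Qed.

Lemma lex_take n u v : u <=L v -> take n u <=L take n v.
Proof.
elim: u v n => [|a u IH] [|b v] [|n] //=; rewrite !lex_cons.
by case/orP => [->//|/andP[/eqP-> /IH ->]]; rewrite eqxx orbT.
Qed.

Lemma lex_split u v : size u = size v -> u <L v ->
  exists s a b u' v',
    [/\ a < b, u = s ++ a :: u', v = s ++ b :: v' & size u' = size v'].
Proof.
elim: u v => [|x u IH] [|y v] //= [e]; rewrite ltNge lex_cons => h.
case: (ltngtP x y) h => [h _|h|/val_inj <-]; last 1 first.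
- rewrite eqxx /= -ltNge => /(IH _ e) [s [a [b [u' [v' [h1 -> -> h2]]]]]].
  by exists (x :: s), a, b, u', v'.
- by exists [::], x, y, u, v.
- by [].
Qed.

Lemma lex_lt_split s a b u v : a < b -> s ++ a :: u <L s ++ b :: v.
Proof.
move=> h; rewrite ltNge lex_cat lex_cons -val_eqE /=.
by case: ltngtP h.
Qed.

(** Ties the stated order, restricted to equal lengths, to the total order on words, whose general
    theory then applies. *)
Lemma lex_ltP u v : lex_lt u v <-> size u = size v /\ u <L v.
Proof.
split=> [[e [s [a [b [h pu pv]]]]]|[e]].
  split=> //; case/prefixP: pu => u' ->; case/prefixP: pv => v' ->.
  by rewrite !cat_rcons; apply: lex_lt_split.
move=> h; split=> //.
have [s [a [b [u' [v' [h1 -> -> _]]]]]] := lex_split e h.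
by exists s, a, b; split => //; rewrite -cat_rcons prefix_prefix.
Qed.

(** There are finitely many words of length [n]: they form the finite type of tuples. *)
Lemma ex_lex_max (P : seq A -> Prop) n :
  (exists2 v, size v = n & P v) ->
  exists v, [/\ size v = n, P v & forall u, size u = n -> P u -> u <=L v].
Proof.
move=> [v0 /eqP s0 p0].
pose Q (t : n.-tuple A) := asb (P (tval t)).
have q0 : Q (Tuple s0) by apply/asbP.
case: (@arg_maxP _ (seqlexi A) _ (Tuple s0) Q (fun t : n.-tuple A => tval t) q0) => v /asbP pv mv.
exists v; split => //; first by rewrite size_tuple.
by move=> u /eqP su pu; apply: (mv (Tuple su)); apply/asbP.
Qed.

Lemma ex_lex_min (P : seq A -> Prop) n :
  (exists2 v, size v = n & P v) ->
  exists v, [/\ size v = n, P v & forall u, size u = n -> P u -> v <=L u].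
Proof.
move=> [v0 /eqP s0 p0].
pose Q (t : n.-tuple A) := asb (P (tval t)).
have q0 : Q (Tuple s0) by apply/asbP.
case: (@arg_minP _ (seqlexi A) _ (Tuple s0) Q (fun t : n.-tuple A => tval t) q0) => v /asbP pv mv.
exists v; split => //; first by rewrite size_tuple.
by move=> u /eqP su pu; apply: (mv (Tuple su)); apply/asbP.
Qed.

End Lex.

(** * Infinite words and their factors *)

Section Infinite.
Variable k : nat.
Notation A := 'I_k.+1.
Implicit Types (a b : A) (s t u v : seq A) (w z x y : nat -> A).

Definition scat s z : nat -> A :=
  fun i => if i < size s then nth ord0 s i else z (i - size s).

Lemma scat_l s z i : i < size s -> scat s z i = nth ord0 s i.
Proof. by rewrite /scat => ->. Qed.

Lemma scat_r s z i : scat s z (size s + i) = z i.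
Proof. by rewrite /scat ltnNge leq_addr /= addKn. Qed.

Lemma mkseq_add z m n :
  mkseq z (m + n) = mkseq z m ++ mkseq (fun j => z (m + j)) n.
Proof.
rewrite /mkseq iotaD map_cat add0n; congr (_ ++ _).
by rewrite -{1}[m]addn0 iotaDl -map_comp.
Qed.

Lemma take_mkseq z m n : m <= n -> take m (mkseq z n) = mkseq z m.
Proof.
by move=> h; rewrite -(subnKC h) mkseq_add take_size_cat ?size_mkseq.
Qed.

Lemma mkseq_scat s z n : mkseq (scat s z) (size s + n) = s ++ mkseq z n.
Proof.
rewrite mkseq_add; congr (_ ++ _); last by apply: eq_mkseq => i; rewrite scat_r.
by rewrite -[RHS](mkseq_nth ord0); apply/eq_in_map => i;
  rewrite mem_iota => /andP[_]; apply: scat_l.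
Qed.

Lemma mkseq_scat1 a z n : mkseq (scat [:: a] z) n.+1 = a :: mkseq z n.
Proof. exact: (mkseq_scat [:: a]). Qed.

Lemma eq_mkseqP y z : (forall n, mkseq y n = mkseq z n) -> y =1 z.
Proof.
move=> h i; have := h i.+1; rewrite !mkseqS => /rcons_inj [_ ->] //.
Qed.

Lemma factor_mkseq w i n : factor w (mkseq (fun j => w (i + j)) n).
Proof. by exists i; rewrite size_mkseq. Qed.

Lemma factorP w v : factor w v <->
  exists i, forall j, j < size v -> nth ord0 v j = w (i + j).
Proof.
split=> [[i e]|[i h]]; exists i.
  by move=> j h; rewrite e nth_mkseq.
apply: (@eq_from_nth _ ord0); rewrite ?size_mkseq // => j hj.
by rewrite nth_mkseq // h.
Qed.

Lemma factor_catl w u v : factor w (u ++ v) -> factor w u.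
Proof.
move=> /factorP[i h]; apply/factorP; exists i => j hj.
by rewrite -h ?size_cat ?nth_cat ?hj //; apply: ltn_addr.
Qed.

Lemma factor_catr w u v : factor w (u ++ v) -> factor w v.
Proof.
move=> /factorP[i h]; apply/factorP; exists (i + size u) => j hj.
rewrite -addnA -h ?size_cat ?ltn_add2l // nth_cat ltnNge leq_addr /=.
by rewrite addKn.
Qed.

Lemma factor_take w n v : factor w v -> factor w (take n v).
Proof. by rewrite -{1}(cat_take_drop n v); apply: factor_catl. Qed.

Lemma factor_ext w v n : factor w v -> exists2 t, size t = n & factor w (v ++ t).
Proof.
move=> [i ->]; exists (mkseq (fun j => w (i + size v + j)) n).
  by rewrite size_mkseq.
have -> : mkseq (fun j => w (i + size v + j)) n
    = mkseq (fun j => w (i + (size v + j))) n.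
  by apply: eq_mkseq => j; rewrite addnA.
by rewrite -(mkseq_add (fun j => w (i + j))); apply: factor_mkseq.
Qed.

Lemma factor_nil w : factor w [::].
Proof. by exists 0. Qed.

(** Such [z] are the points of the closure of the shift orbit of [w]. *)
Definition language_limit w z : Prop := forall n, factor w (mkseq z n).

(* The largest continuations of s of the various lengths are prefixes of one
   another. *)
Lemma ex_sup w s : factor w s -> exists z,
  (forall n, factor w (s ++ mkseq z n)) /\
  forall t, factor w (s ++ t) -> t <=L mkseq z (size t).
Proof.
move=> fs.
have hM n : exists v, [/\ size v = n, factor w (s ++ v)
    & forall u, size u = n -> factor w (s ++ u) -> u <=L v].
  by apply: ex_lex_max; have [t] := factor_ext n fs; exists t.
have [M hM'] := choice _ hM.
have takeM n : take n (M n.+1) = M n.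
  have [s1 f1 m1] := hM' n; have [s2 f2 m2] := hM' n.+1.
  apply: lex_anti.
    apply: m1; first by rewrite size_takel // s2.
    by have := factor_take (size s + n) f2; rewrite takeD take_size_cat // drop_size_cat.
  (* Conversely, a one-letter extension of [M n] competes with [M n.+1]. *)
  have [t st ft] := factor_ext 1 f1.
  have := m2 (M n ++ t); rewrite size_cat s1 st addn1 catA => /(_ erefl ft).
  by move/(lex_take n); rewrite take_size_cat.
pose z i := nth ord0 (M i.+1) i.
have preM n : mkseq z n = M n.
  elim: n => [|n IH]; first by case: (hM' 0) => /size0nil ->.
  rewrite mkseqS IH -takeM /z; case: (hM' n.+1) => e _ _.
  by rewrite -take_nth ?e // -{1}e take_size.
exists z; split=> [n|t ft]; rewrite preM; first by case: (hM' n).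
by case: (hM' (size t)) => _ _; apply.
Qed.

End Infinite.

(** * Complementation: the exchange of the letters [a] and [k - a] *)

Section Complement.
Variable k : nat.
Notation A := 'I_k.+1.
Implicit Types (a b : A) (s t u v : seq A) (w z x y : nat -> A).

Definition compl v : seq A := map (@rev_ord k.+1) v.
Definition complw w : nat -> A := fun i => rev_ord (w i).

Lemma complK : involutive compl.
Proof. by move=> v; rewrite /compl -map_comp map_id_in // => a _; apply: rev_ordK. Qed.

Lemma complwK w : complw (complw w) =1 w.
Proof. by move=> i; apply: rev_ordK. Qed.

Lemma mkseq_complw w n : mkseq (complw w) n = compl (mkseq w n).
Proof. by rewrite /compl -map_comp. Qed.

Lemma eq_factor w w' v : w =1 w' -> factor w v -> factor w' v.
Proof. by move=> e [i ->]; exists i; rewrite size_mkseq; apply: eq_mkseq. Qed.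

Lemma factor_compl w v : factor w v -> factor (complw w) (compl v).
Proof.
by move=> [i ->]; exists i; rewrite size_map size_mkseq -mkseq_complw.
Qed.

Lemma factor_complE w v : factor (complw w) v <-> factor w (compl v).
Proof.
split=> [/factor_compl|/factor_compl]; last by rewrite complK.
by apply: eq_factor; apply: complwK.
Qed.

(** Equal sizes matter: a proper prefix still precedes its extensions after complementation. *)
Lemma lex_compl u v : size u = size v -> (compl u <=L compl v) = (v <=L u).
Proof.
elim: u v => [|a u IH] [|b v] //= [e]; rewrite !lex_cons IH //.
rewrite (inj_eq rev_ord_inj) eq_sym /=; congr (_ || _).
have := ltn_ord a; have := ltn_ord b; lia.
Qed.

Lemma lex_lt_compl u v : lex_lt u v -> lex_lt (compl v) (compl u).
Proof.
move=> /lex_ltP[e h]; apply/lex_ltP; rewrite !size_map e; split=> //.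
by rewrite ltNge lex_compl // -ltNge.
Qed.

Lemma is_succ_compl w v v' :
  is_succ (complw w) v v' -> is_succ w (compl v') (compl v).
Proof.
move=> [/factor_complE f1 /factor_complE f2 /lex_lt_compl h hn]; split=> //.
move=> [f [ff /lex_lt_compl h1 /lex_lt_compl h2]]; apply: hn; exists (compl f).
by rewrite !complK in h1 h2; split=> //; apply: factor_compl.
Qed.

(** Complementation reverses succession: the two words trade places, and [a < b] becomes
    [rev_ord b < rev_ord a]. *)
Lemma NFOp_compl w : NFOp_i w -> NFOp_i (complw w).
Proof.
move=> h v v' /is_succ_compl/h [a [b [l [m [ab hh]]]]].
exists (rev_ord b), (rev_ord a), (compl l), (compl m).
split; first by rewrite /=; have := ltn_ord b; lia.
rewrite -[v]complK -[v']complK; case: hh => -[-> ->]; [left|right].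
  by rewrite /compl !map_cat.
by rewrite /compl !map_rcons.
Qed.

Lemma ultimately_periodic_compl w :
  ultimately_periodic w -> ultimately_periodic (complw w).
Proof.
by move=> [N [p [p0 h]]]; exists N, p; split=> // n hn; rewrite /complw h.
Qed.

(** Dual of [ex_sup], by complementation. *)
Lemma ex_inf w s : factor w s -> exists z,
  (forall n, factor w (s ++ mkseq z n)) /\
  forall t, factor w (s ++ t) -> mkseq z (size t) <=L t.
Proof.
move=> /factor_compl/ex_sup [z [h1 h2]]; exists (complw z); split=> [n|t].
  by have /factor_complE := h1 n; rewrite /compl map_cat -!/(compl _) complK mkseq_complw.
move=> /factor_compl; rewrite /compl map_cat => /h2.
rewrite size_map -/(compl t) -[X in _ <=L X]complK lex_compl ?mkseq_complw //.
by rewrite [RHS]size_map size_mkseq.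
Qed.
End Complement.

(** * Consecutive factors and the exclusion of a third letter *)

Section Gap.
Variable k : nat.
Notation A := 'I_k.+1.
Implicit Types (a b c : A) (s t u v : seq A) (w z x y : nat -> A).

Lemma lex_between s a b u v f :
  size f = size (s ++ a :: u) -> s ++ a :: u <=L f -> f <=L s ++ b :: v ->
  exists c t, [/\ f = s ++ c :: t, size t = size u, a <= c & c <= b].
Proof.
elim: s f => [|d s IH] [|c f] //= [e]; rewrite !lex_cons => h1 h2.
  exists c, f; split=> //.
    by case/orP: h1 => [/ltnW|/andP[/eqP-> _]].
  by case/orP: h2 => [/ltnW|/andP[/eqP-> _]].
have ec : d = c.
  by apply: val_inj; move: h1 h2; rewrite -!val_eqE /=; case: ltngtP.
move: h1 h2; rewrite ec ltnn eqxx /= => h1 h2.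
by have [c' [t [-> *]]] := IH f e h1 h2; exists c', t.
Qed.

(** The first position where two words differ is determined by the words. *)
Lemma first_diff_inj s l a b a' b' u v u' v' : a != b -> a' != b' ->
  s ++ a :: u = l ++ a' :: u' -> s ++ b :: v = l ++ b' :: v' ->
  [/\ s = l, a = a', b = b', u = u' & v = v'].
Proof.
move=> ab ab'; elim: s l => [|c s IH] [|d l] //=.
- by move=> [-> ->] [-> ->].
- by move=> [e _] [e' _]; rewrite e e' eqxx in ab.
- by move=> [e _] [e' _]; rewrite -e -e' eqxx in ab'.
by move=> [-> e] [e']; have [-> -> -> -> ->] := IH _ e e'.
Qed.

Lemma mkseq_cons z n : mkseq z n.+1 = z 0 :: mkseq (fun i => z i.+1) n.
Proof. exact: (mkseq_add z 1 n). Qed.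

(* The last factor with prefix [rcons s a] and the first one with prefix
   [rcons s b] are consecutive at every length. *)
Lemma NFOp_gap w s a b : NFOp_i w -> a < b ->
  factor w (rcons s a) -> factor w (rcons s b) ->
  (forall c, a < c < b -> ~ factor w (rcons s c)) ->
  exists x, [/\ forall n, factor w (s ++ a :: b :: mkseq x n),
    forall n, factor w (s ++ b :: a :: mkseq x n),
    forall t, factor w (s ++ a :: t) -> t <=L mkseq (scat [:: b] x) (size t) &
    forall t, factor w (s ++ b :: t) -> mkseq (scat [:: a] x) (size t) <=L t].
Proof.
move=> nf ab /ex_sup [z [fz sz]] /ex_inf [z' [fz' sz']] gap.
have key n : z 0 = b /\ z' 0 = a /\
    mkseq (fun i => z i.+1) n = mkseq (fun i => z' i.+1) n.
  (* At least one letter follows [a] and [b], which rules out words differing only in their last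
     letter; so the NFOp swaps the letter after [s] with the next one. *)
  have : is_succ w (rcons s a ++ mkseq z n.+1) (rcons s b ++ mkseq z' n.+1).
    split=> //; first by apply/lex_ltP; rewrite !size_cat !size_rcons !size_mkseq;
      split=> //; rewrite !cat_rcons; apply: lex_lt_split.
    move=> [f [ff /lex_ltP[e1 h1] /lex_ltP[e2 h2]]].
    move: e1 h1 h2; rewrite !cat_rcons => e1 h1 h2.
    have [c [t [ef st ac cb]]] := lex_between (esym e1) (ltW h1) (ltW h2).
    rewrite ef in ff h1 h2; rewrite size_mkseq in st.
    have [eac|nac] := eqVneq a c.
      move: h1; rewrite -eac ltNge lex_cat lex_cons ltnn eqxx /=.
      by rewrite -st sz // cat_rcons eac.
    have [ebc|nbc] := eqVneq b c.
      move: h2; rewrite -ebc ltNge lex_cat lex_cons ltnn eqxx /=.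
      by rewrite -st sz' // cat_rcons ebc.
    apply: (gap c).
      by move: nac nbc ac cb; rewrite -!val_eqE /=; lia.
    by move: ff; rewrite -cat_rcons; apply: factor_catl.
  move=> /nf[a' [b' [l [m [ab' hh]]]]].
  have nab : a != b by rewrite -val_eqE /=; lia.
  have nab' : a' != b' by rewrite -val_eqE /=; lia.
  rewrite !cat_rcons -!cats1 !mkseq_cons in hh.
  case: hh => -[e1 e2]; have := first_diff_inj nab nab' e1 e2.
    by move=> [_ ea eb [-> ->] [-> ->]]; rewrite ea eb.
  by case.
exists (fun i => z i.+1).
have ez n : mkseq (scat [:: b] (fun i => z i.+1)) n = mkseq z n.
  by case: n => // n; rewrite mkseq_scat1 mkseq_cons; case: (key n) => ->.
have ez' n : mkseq (scat [:: a] (fun i => z i.+1)) n = mkseq z' n.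
  by case: n => // n; rewrite mkseq_scat1 mkseq_cons; case: (key n) => _ [-> ->].
split=> [n|n|t ft|t ft].
- by have := fz n.+1; rewrite -ez mkseq_scat1 cat_rcons.
- by have := fz' n.+1; rewrite -ez' mkseq_scat1 cat_rcons.
- by rewrite ez; apply: sz; rewrite cat_rcons.
- by rewrite ez'; apply: sz'; rewrite cat_rcons.
Qed.

(** Iterating the hypothesis gives [z >= az >= aaz >= ...]. *)
Lemma nseq_ge n a z : (forall n, a :: mkseq z n <=L mkseq z n.+1) ->
  mkseq (fun=> a) n <=L mkseq z n.
Proof.
move=> h; elim: n => [|n IH]; first exact: lex_refl.
apply: lex_trans (h n); rewrite mkseq_cons lex_cons ltnn eqxx /=.
exact: IH.
Qed.

Lemma nseq_le n a z : (forall n, mkseq z n.+1 <=L a :: mkseq z n) ->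
  mkseq z n <=L mkseq (fun=> a) n.
Proof.
move=> h; elim: n => [|n IH]; first exact: lex_refl.
apply: lex_trans (h n) _; rewrite mkseq_cons lex_cons ltnn eqxx /=.
exact: IH.
Qed.

Lemma factor_letter w i : factor w [:: w i].
Proof. by exists i; rewrite /mkseq /= addn0. Qed.

(** Every continuation of [a] is at most [bx], by the gap lemma with [s] empty. As [bax] gives
    factors, [x] continues [a], so [x <= bx] and thus [x <= bbb...]; a run of [b] after [a] is then
    never followed by a larger letter. *)
Lemma no_ascent w a b c j : NFOp_i w -> (forall d, exists n, w n = d) ->
  b = a.+1 :> nat -> b < c -> ~ factor w (a :: mkseq (fun=> b) j ++ [:: c]).
Proof.
move=> nf hw ba bc hf.
have fl d : factor w [:: d] by case: (hw d) => n <-; apply: factor_letter.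
have [||||x [h1 h2 h3 h4]] := @NFOp_gap w [::] a b nf.
- by rewrite ba.
- exact: fl.
- exact: fl.
- by move=> d; lia.
have hx n : mkseq x n.+1 <=L b :: mkseq x n.
  have /= h := factor_catr (u := [:: b]) (h2 n.+1).
  have := h3 (mkseq x n.+1) (factor_catr (u := [:: b]) (h2 n.+1)).
  by rewrite size_mkseq mkseq_scat1.
have := h3 _ hf; rewrite size_cat size_mkseq addn1 mkseq_scat1 => h.
have h' : mkseq (fun=> b) j ++ [:: c] <=L mkseq (fun=> b) j.+1.
  apply: (lex_trans h); rewrite mkseq_cons lex_cons ltnn eqxx /=.
  exact: nseq_le.
by move: h'; rewrite mkseqS -cats1 lex_cat lex_cons -val_eqE /=; lia.
Qed.

(** Image of [no_ascent] under complementation, where [a] and [b] exchange roles. *)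
Lemma no_descent w a b c j : NFOp_i w -> (forall d, exists n, w n = d) ->
  b = a.+1 :> nat -> c < a -> ~ factor w (b :: mkseq (fun=> a) j ++ [:: c]).
Proof.
move=> nf hw ba ca /factor_compl; rewrite /= /compl map_cat -!/(compl _).
rewrite -mkseq_complw /=; apply: no_ascent; rewrite /complw /=.
- exact: NFOp_compl.
- by move=> d; have [n e] := hw (rev_ord d); exists n; rewrite e rev_ordK.
- by have := ltn_ord b; lia.
- by have := ltn_ord b; lia.
Qed.

Lemma ex_run w a (P Q : pred A) i j :
  (forall b, [|| P b, b == a | Q b]) -> i <= j -> P (w i) -> Q (w j) ->
  ~~ Q a -> (forall b, P b -> ~~ Q b) ->
  exists b c n, [/\ P b, Q c & factor w (b :: mkseq (fun=> a) n ++ [:: c])].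
Proof.
move=> hPQ /subnKC<- Pi Qj Qa PQ; move: (j - i) Qj => d Qj.
apply: NNPP => hn.
(* Unless the wanted factor appears, position [i + d] ends a run of [m] letters [a] that follows a
   letter in [P]. *)
have [p [m [e pp hm]]] : exists p m, [/\ p + m = i + d, P (w p) &
    mkseq (fun r => w (p.+1 + r)) m = mkseq (fun=> a) m].
  elim: d {Qj} => [|d [p [m [e pp hm]]]]; first by exists i, 0.
  case/or3P: (hPQ (w (i + d.+1))) => h.
  - by exists (i + d.+1), 0; rewrite addn0.
  - exists p, m.+1; rewrite !addnS e; split=> //.
    by rewrite !mkseqS hm addSn e -addnS (eqP h).
  case: hn; exists (w p), (w (i + d.+1)), m; split=> //.
  rewrite cats1 -hm addnS -e -addSn -mkseqS -[p in w p]addn0.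
  have := factor_mkseq w p m.+2; rewrite mkseq_cons.
  have -> // : mkseq (fun r => w (p + r.+1)) m.+1 = mkseq (fun r => w (p.+1 + r)) m.+1.
  by apply: eq_mkseq => r; rewrite addnS.
move: Qj; rewrite -e; case: m hm {e} => [_|m]; first by rewrite addn0; apply/negP/PQ.
by rewrite !mkseqS => /rcons_inj[_]; rewrite addSnnS => ->; apply/negP.
Qed.

(** Split the letters into 0, 1 and those above 1. Between an occurrence of 0 and one of 2, in
    either order, there is a run of 1 joining the two outer classes, which is a forbidden ascent or
    descent. *)
Lemma NFOp_binary w : NFOp_i w -> (forall d, exists n, w n = d) -> k <= 1.
Proof.
move=> nf hw; rewrite leqNgt; apply/negP => k2.
have [i0 e0] := hw ord0; have [i2 e2] := hw (inord 2).
have v2 : (inord 2 : A) = 2 :> nat by rewrite inordK.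
have v1 : (inord 1 : A) = 1 :> nat by rewrite inordK //; lia.
case: (leqP i0 i2) => [h|/ltnW h].
  have [|||||b [c [n [b0 c2]]]] :=
    @ex_run w (inord 1) (pred1 ord0) [pred c : A | 1 < c] _ _ _ h.
  - by move=> b /=; rewrite -!val_eqE /= v1; case: (nat_of_ord b) => [|[]].
  - by rewrite /= e0.
  - by rewrite /= e2 v2.
  - by rewrite /= v1.
  - by move=> b /eqP->.
  rewrite (eqP b0); apply: no_ascent; rewrite ?v1 //.
have [|||||b [c [n [b2 c0]]]] :=
  @ex_run w (inord 1) [pred c : A | 1 < c] (pred1 ord0) _ _ _ h.
- by move=> b /=; rewrite -!val_eqE /= v1; case: (nat_of_ord b) => [|[|[]]].
- by rewrite /= e2 v2.
- by rewrite /= e0.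
- by rewrite /= -val_eqE /= v1.
- by move=> b /=; rewrite -val_eqE /=; lia.
rewrite (eqP c0) => hf.
(* If [b > 2], the letter after [b] is 0 or 1, hence below [b - 1]: a forbidden descent with an
   empty run of [b - 1]. *)
have [b2'|b3] : b = 2 :> nat \/ 2 < b by move: b2 => /=; lia.
  by apply: (no_descent nf hw _ _ hf); rewrite ?v1.
have vb : (inord b.-1 : A) = b.-1 :> nat.
  by rewrite inordK //; have := ltn_ord b; lia.
have [c1 [hc hf']] : exists c : A, c < b.-1 /\ factor w [:: b; c].
  case: n hf => [|n] hf.
    by exists ord0; split; first by rewrite /=; lia.
  exists (inord 1); split; first by rewrite v1; lia.
  by move: hf; rewrite mkseq_cons; apply: (@factor_catl _ _ [:: b; inord 1]).
by apply: (@no_descent w (inord b.-1) b c1 0 nf hw) => //; rewrite ?vb; lia.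
Qed.
End Gap.

(** * Ultimately periodic words with the NFOp *)

Section Aperiodicity.
Variable k : nat.
Notation A := 'I_k.+1.
Implicit Types (a b c : A) (s t u v f : seq A) (w z x y : nat -> A).

(** The factors of length [n] form a finite chain. The least factor above [u] with another value of
    [g] has a predecessor sharing that value, which is a smaller counterexample. *)
Lemma succ_invariant w n (T : Type) (g : seq A -> T) :
  (forall v v', size v = n -> is_succ w v v' -> g v = g v') ->
  forall u v, factor w u -> factor w v -> size u = n -> size v = n -> g u = g v.
Proof.
move=> hg u v; wlog uv : u v / u <=L v.
  move=> H fu fv su sv; case: (boolP (u <=L v)) => [h|/lexNle h]; first exact: H.
  by symmetry; apply: H.
move=> fu fv su sv; apply: NNPP => ne.
have uv' : u <L v.
  by rewrite lt_neqAle uv andbT; apply/eqP => e; apply: ne; rewrite e.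
have [|v1 [s1 [f1 lt1 ne1] min1]] :=
    @ex_lex_min k (fun f => [/\ factor w f, u <L f & g u <> g f]) n.
  by exists v.
have [|f [sf [ff ltf] maxf]] := @ex_lex_max k (fun f => factor w f /\ f <L v1) n.
  by exists u.
have ef : g f = g v1.
  apply: hg => //; split=> //; first by apply/lex_ltP; rewrite sf s1.
  move=> [f' [ff' /lex_ltP[e1 l1] /lex_ltP[e2 l2]]].
  by have := maxf f'; rewrite -e1 leNgt l1 => /(_ sf (conj ff' l2)).
have uf : u <=L f by apply: maxf.
have := min1 f sf; rewrite leNgt ltf => H.
suff : false by []; apply: H; split; rewrite ?ef //.
by rewrite lt_neqAle uf andbT; apply/eqP => e; apply: ne1; rewrite e.
Qed.

(* If all long factors have period p >= 2 after position N, two consecutive ones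
   can only differ before position N + 1, since a difference propagates by p. *)
Lemma NFOp_eventually_constant w N p : NFOp_i w -> 0 < p ->
  (forall n, N <= n -> w (n + p) = w n) -> forall n, N < n -> w n = w N.+1.
Proof.
move=> nf p1 hp1.
(* Doubling the period makes it at least 2, so that a shift by it leaves the two swapped letters. *)
have [q [p2 hp]] : exists q, 1 < q /\ forall n, N <= n -> w (n + q) = w n.
  exists (p + p); split; first by lia.
  by move=> n hn; rewrite addnA !hp1 //; lia.
(* With this length, a position from [N] on can be compared with the one [p] later or, failing that,
   [p] earlier and still at least [N]. *)
move: q p2 hp {p p1 hp1} => p p2 hp; pose L := N + p + p.
have per v r : factor w v -> size v = L -> N <= r -> r + p < L ->
    nth ord0 v (r + p) = nth ord0 v r.
  move=> /factorP[i hi] sv hr hrp; rewrite !hi ?sv //; last by lia.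
  by rewrite addnA hp //; lia.
have inv v v' : size v = L -> is_succ w v v' -> drop N.+1 v = drop N.+1 v'.
  move=> sv hs; have [fv fv' /lex_ltP[sv' _] _] := hs; rewrite sv in sv'.
  have [a [b [l [m [ab [[ev ev']|[ev ev']]]]]]] := nf _ _ hs; last first.
    have sl : (size l).+1 = L by rewrite -sv ev size_rcons.
    have := per v (size l - p) fv sv; have := per v' (size l - p) fv' (esym sv').
    have -> : size l - p + p = size l by lia.
    rewrite ev ev' !nth_rcons ltnn eqxx.
    have -> : size l - p < size l by lia.
    move=> h1 h2; have e : b = a by rewrite h1 ?h2 //; lia.
    by rewrite e ltnn in ab.
  have sl : size l + 2 + size m = L by rewrite -sv ev !size_cat /=; lia.
  have nl r c d : nth ord0 (l ++ [:: c; d] ++ m) (size l + r)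
      = nth ord0 ([:: c; d] ++ m) r.
    by rewrite nth_cat ltnNge leq_addr addKn.
  have n0 c d : nth ord0 (l ++ [:: c; d] ++ m) (size l) = c.
    by have := nl 0 c d; rewrite addn0.
  have nlt r c d : r < size l -> nth ord0 (l ++ [:: c; d] ++ m) r = nth ord0 l r.
    by rewrite nth_cat => ->.
  (* A swap starting before [N] lies within the first [N.+1] letters, which [drop] removes. *)
  have [h|h] := leqP N (size l); last first.
    rewrite ev ev' !catA !drop_cat !size_cat /= ltnNge.
    by have -> : size l + 2 <= N.+1 by lia.
  suff e : b = a by rewrite e ltnn in ab.
  case: (ltnP (size l + p) L) => hL.
    have := per v (size l) fv sv h hL; have := per v' (size l) fv' (esym sv') h hL.
    rewrite ev ev' !nl !n0 => <- <-.
    by case: p p2 {hp per L sv sv' sl hL} => [|[]].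
  have := per v (size l - p) fv sv; have := per v' (size l - p) fv' (esym sv').
  have -> : size l - p + p = size l by lia.
  rewrite ev ev' !n0 !nlt; try lia.
  by move=> h1 h2; rewrite h1 ?h2 //; lia.
have key := succ_invariant inv.
(* The first letters kept by [drop] in these two factors are [w n] and [w N.+1]. *)
move=> n hn; have e := key _ _ (factor_mkseq w (n - N.+1) L) (factor_mkseq w 0 L).
rewrite !size_mkseq in e; have {e} := congr1 (fun s => nth ord0 s 0) (e erefl erefl).
rewrite !nth_drop !nth_mkseq /L; try lia.
by rewrite addn0 subnK.
Qed.

End Aperiodicity.

(** * Binary words: numbers of ones and balance *)

Section Binary.
Notation A := 'I_2.
Notation l0 := (ord0 : 'I_2).
Notation l1 := (ord_max : 'I_2).
Notation ones := (count_mem l1).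
Implicit Types (a b c : A) (s t u v f : seq A) (w z x y : nat -> A).

Lemma letterP a : a = l0 \/ a = l1.
Proof. by case: a => [[|[|m]] h] //; [left|right]; apply: val_inj. Qed.

Lemma letter_lt a b : a < b -> a = l0 /\ b = l1.
Proof. by case: (letterP a) => ->; case: (letterP b) => ->. Qed.

Lemma ones_zeros v : count_mem l0 v + ones v = size v.
Proof. by elim: v => //= a v <-; case: (letterP a) => -> /=; lia. Qed.

(** Consider the first difference: either it is 0 against 1, or it is 1 against 0 and the suffixes
    after it differ by at least two ones. *)
Lemma lighter_word s t : size s = size t -> ones s < ones t ->
  (exists q r r', s = q ++ l0 :: r /\ t = q ++ l1 :: r') \/
  (exists p p' s' t', [/\ s = p ++ s', t = p' ++ t', size s' = size t',
     size s' < size s & (ones s').+1 < ones t']).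
Proof.
elim: s t => [|a s IH] [|b t] //= [e].
case: (letterP a) => ->; case: (letterP b) => -> /=.
- rewrite !add0n => /(IH _ e)[[q [r [r' [-> ->]]]]|].
    by left; exists (l0 :: q), r, r'.
  move=> [p [p' [s' [t' [-> -> h1 h2 h3]]]]]; right.
  by exists (l0 :: p), (l0 :: p'), s', t'; split=> //; apply: ltnW.
- by move=> _; left; exists [::], s, t.
- by move=> h; right; exists [:: l1], [:: l0], s, t; split => //=; lia.
- rewrite !add1n ltnS => /(IH _ e)[[q [r [r' [-> ->]]]]|].
    by left; exists (l1 :: q), r, r'.
  move=> [p [p' [s' [t' [-> -> h1 h2 h3]]]]]; right.
  by exists (l1 :: p), (l1 :: p'), s', t'; split=> //; apply: ltnW.
Qed.

Lemma unbalanced_pair w s t : factor w s -> factor w t -> size s = size t ->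
  (ones s).+1 < ones t ->
  exists u, factor w (l0 :: rcons u l0) /\ factor w (l1 :: rcons u l1).
Proof.
move: {2}(size s) (leqnn (size s)) => n.
elim: n s t => [|n IH] [|a s] [|b t] //= hn fs ft [e].
have fs' := factor_catr (u := [:: a]) fs.
have ft' := factor_catr (u := [:: b]) ft.
have [-> | ab] := eqVneq a b; first by rewrite -addnS ltn_add2l; apply: IH.
case: (letterP a) (letterP b) ab => ea [] eb; rewrite ea eb //= => _; last first.
  by rewrite add0n add1n => h; apply: (IH s t) => //; apply: ltnW.
rewrite add0n add1n ltnS => h.
have [[q [r [r' [es et]]]]|[p [p' [s' [t' [es et e' hs ho]]]]]] := lighter_word e h.
  exists q; rewrite -ea -eb in es et *; subst s t; split.
    apply: (@factor_catl _ _ _ r); rewrite /= cat_rcons.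
    by move: fs; rewrite ea.
  apply: (@factor_catl _ _ _ r'); rewrite /= cat_rcons.
  by move: ft; rewrite eb.
apply: (IH s' t') => //; first by apply: leq_trans (ltnW hs) hn.
  by apply: (@factor_catr _ _ p); rewrite -es.
by apply: (@factor_catr _ _ p'); rewrite -et.
Qed.

Lemma balancedI w :
  (forall u, factor w (l0 :: rcons u l0) -> factor w (l1 :: rcons u l1) -> False) ->
  balanced w.
Proof.
move=> h u u' a fu fu' e; rewrite leqNgt; apply/negP => hc.
have := ones_zeros u; have := ones_zeros u'.
case: (letterP a) hc => -> hc h1 h2.
  by have [||v [f1 f2]] := unbalanced_pair fu fu'; [|lia|apply: h f1 f2].
by have [||v [f1 f2]] := unbalanced_pair fu' fu; [|lia|apply: h f1 f2].
Qed.

(** After the first difference, 0 against 1, balance lets [u] regain at most the single one that it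
    lacks. *)
Lemma balanced_lex_ones w u v : balanced w -> factor w u -> factor w v ->
  size u = size v -> u <=L v -> ones u <= ones v.
Proof.
move=> bal fu fv e; rewrite le_eqVlt => /orP[/eqP->//|h].
have [s [a [b [u' [v' [/letter_lt[ea eb] eu ev e']]]]]] := lex_split e h.
rewrite eu ea in fu *; rewrite ev eb in fv *.
have := bal u' v' l1; rewrite -!cat_rcons in fu fv.
move=> /(_ (factor_catr fu) (factor_catr fv) e').
by rewrite !count_cat /=; lia.
Qed.

(** * Right special factors and consecutive factors of Sturmian words *)

Lemma aperiodic_right_special w n : ~ ultimately_periodic w ->
  exists s, [/\ size s = n, factor w (rcons s l0) & factor w (rcons s l1)].
Proof.
move=> aper; apply: NNPP => hn; apply: aper.
(* One block more than there are words of length [n], so two coincide; without right special factors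
   a block determines the next letter, and the word repeats from there. *)
pose f (i : 'I_(#|{: n.-tuple A}|.+1)) : n.-tuple A := [tuple w (i + j) | j < n].
have /injectivePn[i [j nij eij]] : ~~ injectiveb f.
  by apply/injectiveP => /leq_card; rewrite card_ord ltnn.
have block (i' : 'I_(#|{: n.-tuple A}|.+1)) : mkseq (fun r => w (i' + r)) n = f i'.
  apply: (@eq_from_nth _ l0); rewrite size_mkseq ?size_tuple // => r hr.
  by rewrite nth_mkseq // -[r]/(nat_of_ord (Ordinal hr)) -tnth_nth tnth_mktuple.
have det p q : mkseq (fun r => w (p + r)) n = mkseq (fun r => w (q + r)) n ->
    w (p + n) = w (q + n).
  move=> e; apply/eqP/negPn/negP => ne; apply: hn.
  have f1 := factor_mkseq w p n.+1; have f2 := factor_mkseq w q n.+1.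
  rewrite mkseqS in f1; rewrite mkseqS -e in f2.
  exists (mkseq (fun r => w (p + r)) n); rewrite size_mkseq.
  by case: (letterP (w (p + n))) (letterP (w (q + n))) f1 f2 ne
    => -> [] ->; rewrite ?eqxx.
have det' d : mkseq (fun r => w (i + d + r)) n = mkseq (fun r => w (j + d + r)) n.
  elim: d => [|d IH]; first by rewrite !addn0 !block eij.
  have shift p : mkseq (fun r => w (p + r)) n.+1
      = w p :: mkseq (fun r => w (p.+1 + r)) n.
    rewrite mkseq_cons addn0; congr (_ :: _).
    by apply: eq_mkseq => r; rewrite addnS.
  have := shift (i + d); have := shift (j + d).
  rewrite !mkseqS -IH (det _ _ IH) => -> [_ e].
  by rewrite !addnS.
have per d : w (i + d + n) = w (j + d + n) by apply: det.
wlog ij : i j {nij eij det'} per / i < j.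
  move=> H; case: (ltngtP i j) => h; [exact: (H i j)|exact: (H j i)|].
  by case/eqP: nij; apply: val_inj.
exists (i + n), (j - i); split; first by lia.
move=> m hm; have := per (m - (i + n)).
have -> : i + (m - (i + n)) + n = m by lia.
by have -> : j + (m - (i + n)) + n = m + (j - i) by lia.
Qed.

Lemma ones_take_inj s t : size s = size t ->
  (forall j, ones (take j s) = ones (take j t)) -> s = t.
Proof.
elim: s t => [|a s IH] [|b t] //= [e] h.
have := h 1; rewrite /= !take0 /= => hab.
have eab : a = b by case: (letterP a) (letterP b) hab => -> [] ->.
rewrite eab (IH t) // => j; have /= := h j.+1; rewrite eab; lia.
Qed.

Lemma sturmian_succ w v v' : ~ ultimately_periodic w -> balanced w ->
  is_succ w v v' -> exists s t,
    v = s ++ [:: l0; l1] ++ t /\ v' = s ++ [:: l1; l0] ++ t \/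
    v = rcons s l0 /\ v' = rcons s l1.
Proof.
move=> aper bal [fv fv' /lex_ltP[e lt] hn].
have [s [a [b [u [u' [/letter_lt[ea eb] ev ev' eu]]]]]] := lex_split e lt.
rewrite ea in ev; rewrite eb in ev'; move: ea eb => _ _.
(* Shorter factors cannot lie strictly between the prefixes either, since they extend to the full
   length. *)
have gap f : factor w f -> size f <= size v ->
    f <=L take (size f) v \/ take (size f) v' <=L f.
  move=> ff hf; apply: NNPP => /not_or_and[h1 h2]; apply: hn.
  have [t st ft] := factor_ext (size v - size f) ff.
  have sft : size (f ++ t) = size v by rewrite size_cat st subnKC.
  exists (f ++ t); split=> //; apply/lex_ltP; split; rewrite ?sft //.
    by rewrite ltNge; apply/negP => /(lex_take (size f)); rewrite take_size_cat.
  by rewrite ltNge; apply/negP => /(lex_take (size f)); rewrite take_size_cat.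
(* That is, the prefixes of length [m] of [v] and [v'] have equally many ones. *)
have D j : 0 < j -> j <= size u -> ones (take j u) = (ones (take j u')).+1.
  move=> j0 ju; pose m := (size s + j).+1.
  have tv : take m v = s ++ l0 :: take j u.
    by rewrite ev /m -addnS takeD take_size_cat // drop_size_cat.
  have tv' : take m v' = s ++ l1 :: take j u'.
    by rewrite ev' /m -addnS takeD take_size_cat // drop_size_cat.
  have ftv : factor w (take m v) by apply: factor_take.
  have ftv' : factor w (take m v') by apply: factor_take.
  have mv : m <= size v by rewrite ev size_cat /= /m; lia.
  have s1 : size (take m v) = m by rewrite size_takel.
  have s2 : size (take m v') = m by rewrite size_takel // -e.
  have le1 := balanced_lex_ones bal ftv ftv' (etrans s1 (esym s2)) (lex_take m (ltW lt)).
  have le2 := bal _ _ l1 ftv' ftv (etrans s2 (esym s1)).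
  apply: NNPP => nD.
  have o1 : ones (take m v') = (ones (take m v)).+1.
    by move: le1 le2 nD; rewrite tv tv' !count_cat /=; lia.
  (* By balance [r0] and [r1] have as many ones as the two prefixes, respectively; monotonicity then
     puts [r0] below both and [r1] above both. *)
  have [r [sr f0 f1]] := aperiodic_right_special (size s + j) aper.
  have sr0 : size (rcons r l0) = m by rewrite size_rcons sr.
  have sr1 : size (rcons r l1) = m by rewrite size_rcons sr.
  have or0 : ones (rcons r l0) = ones r by rewrite -cats1 count_cat /= !addn0.
  have or1 : ones (rcons r l1) = (ones r).+1 by rewrite -cats1 count_cat /= addn1.
  have b1 := bal _ _ l1 ftv' f0 (etrans s2 (esym sr0)).
  have b2 := bal _ _ l1 f1 ftv (etrans sr1 (esym s1)).
  have eo : ones r = ones (take m v) by lia.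
  have c0 : rcons r l0 <=L take m v.
    have := gap _ f0; rewrite sr0 => /(_ mv)[//|h].
    have := balanced_lex_ones bal ftv' f0 (etrans s2 (esym sr0)) h; lia.
  have c1 : take m v' <=L rcons r l1.
    have := gap _ f1; rewrite sr1 => /(_ mv)[h|//].
    have := balanced_lex_ones bal f1 ftv (etrans sr1 (esym s1)) h; lia.
  have /lex_take c2 : take m v <=L take m v' by apply/lex_take/ltW.
  have tr d : take (size r) (rcons r d) = r by rewrite -cats1 take_size_cat.
  have /(@lex_take _ (size r)) := c0; have /(@lex_take _ (size r)) := c1.
  have := c2 (size r); rewrite !tr => k2 k1 k0.
  have e1 := lex_anti k0 (lex_trans k2 k1).
  have e2 := lex_anti (lex_trans k0 k2) k1.
  (* As [j > 0], this truncation still contains the first difference, just after [s]. *)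
  have : take (size s + j) (take m v) = take (size s + j) (take m v').
    by rewrite -sr -e1 -e2.
  rewrite tv tv' -(prednK j0) !takeD !take_size_cat // !drop_size_cat //=.
  by move/eqP; rewrite eqseq_cat // => /andP[].
exists s; case: u u' ev ev' eu gap D => [|a' u] [|b' u'] //= ev ev' eu _ D.
  by exists [::]; right; rewrite -!cats1.
move: eu => [eu].
have := D 1 isT isT; rewrite /= !take0 /= => hab.
have [ea eb] : a' = l1 /\ b' = l0.
  by case: (letterP a') (letterP b') hab => -> [] ->.
exists u; left; rewrite ev ev' ea eb; split=> //=.
rewrite (ones_take_inj eu) // => j.
wlog ju : j / j <= size u.
  move=> H; case: (leqP j (size u)) => [/H//|/ltnW h].
  by have := H _ (leqnn _); rewrite [in X in _ = X -> _]eu !take_size !take_oversize // -eu.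
by have := D j.+1 isT ju; rewrite /= ea eb /=; lia.
Qed.

(** * The NFOp over two letters: aperiodicity and the common tail *)

(** The factor made of [N.+1] zeros has a successor, and no swap applies to it; the successor thus
    ends in a 1 at index [N], which falls in the constant part of [w]. *)
Lemma NFOp_not_eventually0 w N : NFOp_i w -> (exists i, w i = l1) ->
  ~ (forall n, N <= n -> w n = l0).
Proof.
move=> nf [i wi] h; pose u := mkseq (fun=> l0) N.+1.
have fu : factor w u.
  have -> : u = mkseq (fun r => w (N + r)) N.+1.
    by apply: eq_mkseq => r; rewrite h // leq_addr.
  exact: factor_mkseq.
have [|v [sv [fv uv] minv]] :=
    @ex_lex_min 1 (fun f => factor w f /\ u <L f) N.+1.
  exists (mkseq (fun r => w (i + r)) N.+1); rewrite ?size_mkseq //.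
  split; first exact: factor_mkseq.
  by rewrite ltNge mkseq_cons addn0 wi /u mkseq_cons lex_cons.
have sc : is_succ w u v.
  split=> //; first by apply/lex_ltP; rewrite size_mkseq.
  move=> [f [ff /lex_ltP[e1 lt1] /lex_ltP[e2 lt2]]].
  by have := minv f; rewrite e2 leNgt lt2 => /(_ sv (conj ff lt1)).
have [a [b [l [m [ab [[eu ev]|[eu ev]]]]]]] := nf _ _ sc.
  have : b \in u by rewrite eu !mem_cat !inE eqxx !orbT.
  by move=> /mapP[r _ eb]; rewrite eb in ab.
have [_ eb] := letter_lt ab.
move: fv => /factorP[j /(_ (size l))]; rewrite ev size_rcons nth_rcons ltnn eqxx.
move=> /(_ (leqnn _)); rewrite eb h //.
have := congr1 size eu; rewrite size_rcons size_mkseq => -[->].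
exact: leq_addl.
Qed.

Lemma NFOp_aperiodic w : NFOp_i w -> (forall d, exists n, w n = d) ->
  ~ ultimately_periodic w.
Proof.
move=> nf hw [N [p [p0 hp]]].
have hc := NFOp_eventually_constant nf p0 hp.
case: (letterP (w N.+1)) => e.
  by apply: (@NFOp_not_eventually0 w N.+1 nf (hw l1)) => n hn; rewrite hc.
apply: (@NFOp_not_eventually0 (complw w) N.+1 (NFOp_compl nf)).
  by have [i ei] := hw l0; exists i; rewrite /complw ei; apply: val_inj.
by move=> n hn; rewrite /complw hc // e; apply: val_inj.
Qed.

(* For a Sturmian word, [x] is its characteristic word. *)
Definition common_tail w x : Prop := forall s,
  factor w (rcons s l0) -> factor w (rcons s l1) ->
  [/\ forall n, factor w (s ++ l0 :: l1 :: mkseq x n),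
    forall n, factor w (s ++ l1 :: l0 :: mkseq x n),
    forall t, factor w (s ++ l0 :: t) -> t <=L mkseq (scat [:: l1] x) (size t) &
    forall t, factor w (s ++ l1 :: t) -> mkseq (scat [:: l0] x) (size t) <=L t].

(** The tail [x] of the empty word serves every [s]: if [y] is the tail of [s], then [01y] and [10y]
    give factors, whence [y <= x] and [x <= y]. *)
Lemma NFOp_common_tail w : NFOp_i w -> (forall d, exists n, w n = d) ->
  exists x, common_tail w x.
Proof.
move=> nf hw.
have fl d : factor w [:: d] by case: (hw d) => n <-; apply: factor_letter.
have ng s c : l0 < c < l1 -> ~ factor w (rcons s c).
  by case: (letterP c) => ->.
have gap s h0 h1 := @NFOp_gap 1 w s l0 l1 nf isT h0 h1 (ng s).
have [x [x1 x2 x3 x4]] := gap [::] (fl _) (fl _).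
exists x => s h0 h1.
have [y [y1 y2 y3 y4]] := gap s h0 h1.
have exy n : mkseq y n = mkseq x n.
  apply: lex_anti.
    have := x3 _ (factor_catr (y1 n)).
    by rewrite /= size_mkseq mkseq_scat1 lex_cons ltnn eqxx.
  have := x4 _ (factor_catr (y2 n)).
  by rewrite /= size_mkseq mkseq_scat1 lex_cons ltnn eqxx.
have exy' d n : mkseq (scat [:: d] y) n = mkseq (scat [:: d] x) n.
  by case: n => // n; rewrite !mkseq_scat1 exy.
split=> [n|n|t ft|t ft].
- by rewrite -exy.
- by rewrite -exy.
- by rewrite -exy'; apply: y3.
- by rewrite -exy'; apply: y4.
Qed.

Lemma compl_l0 : rev_ord l0 = l1. Proof. exact: val_inj. Qed.
Lemma compl_l1 : rev_ord l1 = l0. Proof. exact: val_inj. Qed.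

Lemma compl_mkseq_scat1 d x n :
  compl (mkseq (scat [:: d] x) n) = mkseq (scat [:: rev_ord d] (complw x)) n.
Proof. by case: n => // n; rewrite !mkseq_scat1 mkseq_complw. Qed.

Lemma common_tail_compl w x : common_tail w x -> common_tail (complw w) (complw x).
Proof.
move=> h s /factor_complE h1 /factor_complE h0.
rewrite /compl !map_rcons ?compl_l0 ?compl_l1 -/(compl s) in h0 h1.
have [x1 x2 x3 x4] := h _ h0 h1.
split=> [n|n|t|t].
- apply/factor_complE; rewrite /compl map_cat /= compl_l0 compl_l1 -!/(compl _).
  by rewrite mkseq_complw complK.
- apply/factor_complE; rewrite /compl map_cat /= compl_l0 compl_l1 -!/(compl _).
  by rewrite mkseq_complw complK.
- move/factor_complE; rewrite /compl map_cat /= compl_l0 -!/(compl _) => /x4 h'.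
  have := h'; rewrite size_map -lex_compl ?size_mkseq ?size_map //.
  by rewrite complK compl_mkseq_scat1 compl_l0.
- move/factor_complE; rewrite /compl map_cat /= compl_l1 -!/(compl _) => /x3 h'.
  have := h'; rewrite size_map -lex_compl ?size_mkseq ?size_map //.
  by rewrite complK compl_mkseq_scat1 compl_l1.
Qed.

(** * Left extensions and the upper bound [1x] *)

Lemma limit_scat1 w a z :
  language_limit w (scat [:: a] z) <-> forall n, factor w (a :: mkseq z n).
Proof.
split=> h n; first by rewrite -mkseq_scat1; apply: h.
by case: n => [|n]; [apply: factor_nil|rewrite mkseq_scat1].
Qed.

Lemma factor_mkseq_le w s z m n :
  m <= n -> factor w (s ++ mkseq z n) -> factor w (s ++ mkseq z m).
Proof.
by move=> /subnKC<-; rewrite mkseq_add catA; apply: factor_catl.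
Qed.

(** Long prefixes of [z] do not occur at position 0, so a letter precedes them; if each letter
    failed at some length, a prefix longer than both would have no left extension. *)
Lemma limit_extend_left w z n : language_limit w z -> mkseq z n <> mkseq w n ->
  exists a, language_limit w (scat [:: a] z).
Proof.
move=> hz ne; apply: NNPP => hn.
have bad a : exists m, ~ factor w (a :: mkseq z m).
  apply: NNPP => h; apply: hn; exists a; apply/limit_scat1 => m.
  by apply: NNPP => h'; apply: h; exists m.
have [m0 h0] := bad l0; have [m1 h1] := bad l1.
have [[|i] e] := hz (n + m0 + m1); rewrite size_mkseq in e.
  apply: ne; rewrite -(take_mkseq z (_ : n <= n + m0 + m1)) ?e ?take_mkseq //; lia.
have hf : factor w ([:: w i] ++ mkseq z (n + m0 + m1)).
  rewrite e; exists i; rewrite /= size_mkseq mkseq_cons addn0; congr (_ :: _).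
  by apply: eq_mkseq => r; rewrite addnS.
case: (letterP (w i)) => ei; rewrite ei in hf.
  by apply: h0; apply: factor_mkseq_le hf; lia.
by apply: h1; apply: factor_mkseq_le hf; lia.
Qed.

Lemma lex_l1_max v n : size v = n -> v <=L mkseq (fun=> l1) n.
Proof.
elim: v n => [|a v IH] [|n] //= [e]; rewrite mkseq_cons lex_cons.
by case: (letterP a) => ->; rewrite //= IH.
Qed.

(** Slide the run of ones to the left until a 0 precedes it, at position [i] at the latest. *)
Lemma l1_run w n i j : w i = l0 -> i <= j ->
  mkseq (fun r => w (j + r)) n = mkseq (fun=> l1) n ->
  factor w (l0 :: mkseq (fun=> l1) n).
Proof.
move=> wi /subnKC<-; elim: (j - i) => [|d IH] e.
  case: n e => [|n]; first by rewrite -wi => _; apply: factor_letter.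
  by rewrite !mkseq_cons !addn0 wi => -[].
have e' : mkseq (fun r => w (i + d + r)) n.+1 = w (i + d) :: mkseq (fun=> l1) n.
  rewrite mkseq_cons addn0 -e; congr (_ :: _).
  by apply: eq_mkseq => r; rewrite !addnS.
case: (letterP (w (i + d))) => ed.
  by have := factor_mkseq w (i + d) n.+1; rewrite e' ed.
apply: IH; rewrite -(take_mkseq _ (leqnSn n)) e' ed.
by rewrite -[_ :: _](mkseq_cons (fun=> l1)) take_mkseq.
Qed.

(** Maximality gives [1M <= M], so [M] consists of ones only; arbitrarily long runs of ones then
    occur after a 0. *)
Lemma factor_l0_max w M : (exists i, w i = l0) -> language_limit w M ->
  (forall t, factor w t -> t <=L mkseq M (size t)) ->
  (forall n, factor w (l1 :: mkseq M n)) -> forall n, factor w (l0 :: mkseq M n).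
Proof.
move=> [j wj] fM sM h n.
have eM m : mkseq M m = mkseq (fun=> l1) m.
  apply: lex_anti; first by apply: lex_l1_max; rewrite size_mkseq.
  by apply: nseq_ge => r; have := sM _ (h r); rewrite /= size_mkseq.
(* The extra [j.+1] letters keep the run from starting before [j], as it would cover the 0 there. *)
have [i ei] := fM (j.+1 + n); rewrite size_mkseq eM in ei.
have hi r : r < j.+1 + n -> w (i + r) = l1.
  by move=> hr; have := congr1 (fun s => nth l0 s r) ei; rewrite /= !nth_mkseq.
rewrite eM; apply: (l1_run (j := i) wj).
  rewrite leqNgt; apply/negP => ij.
  by have := hi (j - i); rewrite (subnKC (ltnW ij)) wj => h'; have := h' ltac:(lia).
apply: (@eq_from_nth _ l0); rewrite !size_mkseq // => r hr.
by rewrite !nth_mkseq // hi //; lia.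
Qed.

(* If w is not left extendable and [s] is its longest prefix such that [s1] is a
   prefix of w and [s0] is a factor, then w = s10x, and every other factor is at
   most y = s01x.  Extending y to the left by 0 gives y <= 1x, hence y = 1x and x
   is periodic; extending it by 1 gives y = 111..., absurd, or w = 1y,
   and then x is constant. *)
Lemma factor_le_tail_maximal w x : ~ ultimately_periodic w -> common_tail w x ->
  factor w [:: l0] -> (forall t, factor w t -> t <=L mkseq w (size t)) ->
  forall n0, (forall a, ~ factor w (a :: mkseq w n0)) ->
  forall t, factor w t -> t <=L mkseq (scat [:: l1] x) (size t).
Proof.
move=> aper hx f0 wmax n0 nleft.
have uniq i : mkseq (fun r => w (i + r)) n0 = mkseq w n0 -> i = 0.
  case: i => // i e; case: (nleft (w i)).
  exists i; rewrite /= size_mkseq mkseq_cons addn0 -e; congr (_ :: _).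
  by apply: eq_mkseq => r; rewrite addnS.
have fw n : factor w (mkseq w n) by apply: (factor_mkseq w 0).
have [i1 w1] : exists i, w i = l1.
  apply: NNPP => h; apply: aper; exists 0, 1; split=> // n _.
  have all0 i : w i = l0.
    by case: (letterP (w i)) => // e; case: h; exists i.
  by rewrite !all0.
pose P m := asb (w m = l1 /\ factor w (rcons (mkseq w m) l0)).
have P0 : P 0.
  apply/asbP; split=> //; have := factor_letter w i1; rewrite w1 => /wmax.
  by rewrite mkseq_cons lex_cons; case: (letterP (w 0)) => ->.
(* For [m > n0] the occurrence would start at position 0 and read 1 instead of 0 at index [m]. *)
have Pub m : P m -> m <= n0.
  move=> /asbP[wm /factorP[i hi]]; rewrite leqNgt; apply/negP => hm.
  rewrite size_rcons size_mkseq in hi.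
  have i0 : i = 0.
    apply: uniq; apply: (@eq_from_nth _ l0); rewrite !size_mkseq // => r hr.
    rewrite !nth_mkseq // -hi; last by lia.
    by rewrite nth_rcons size_mkseq nth_mkseq; (have -> : r < m by lia).
  have := hi m (leqnn _); rewrite i0 nth_rcons size_mkseq ltnn eqxx add0n wm.
  by [].
have [m /asbP[wm fm0] maxm] := ex_maxnP (ex_intro _ 0 P0) Pub.
pose s := mkseq w m.
have es1 : rcons s l1 = mkseq w m.+1 by rewrite mkseqS wm.
have fs1 : factor w (rcons s l1) by rewrite es1.
have [x1 x2 x3 x4] := hx s fm0 fs1.
have [z1 z2 z3 z4] := hx [::] f0 (factor_catr (u := s) (eq_ind _ _ fs1 _ (esym (cats1 _ _)))).
(* A deviation from [w] after [s1] is either 0 for 1, against the choice of [m], or 1 for 0, against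
   the maximality of [w]. *)
have only t : factor w (mkseq w m.+1 ++ t) ->
    mkseq w m.+1 ++ t = mkseq w (m.+1 + size t).
  elim/last_ind: t => [|t a IH]; first by rewrite cats0 addn0.
  rewrite -rcons_cat size_rcons addnS => ft.
  have e : mkseq w m.+1 ++ t = mkseq w (m.+1 + size t).
    by apply: IH; move: ft; rewrite -cats1; apply: factor_catl.
  rewrite e in ft *; rewrite mkseqS; congr rcons.
  case: (letterP a) (letterP (w (m.+1 + size t))) => ea [] ew; rewrite ea ew //.
    have : m.+1 + size t <= m by apply: maxm; apply/asbP; split; rewrite -?ea.
    by lia.
  have := wmax _ ft; rewrite size_rcons size_mkseq mkseqS ea ew -!cats1 lex_cat.
  by rewrite lex_cons.
have [w0 ex] : w m.+1 = l0 /\ forall i, x i = w (m.+2 + i).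
  have e n : l0 :: mkseq x n = mkseq (fun r => w (m.+1 + r)) n.+1.
    have := only (l0 :: mkseq x n); rewrite -es1 cat_rcons => /(_ (x2 n)).
    rewrite -cat_rcons es1 [size _]/= size_mkseq mkseq_add => /eqP.
    by rewrite eqseq_cat // => /andP[_ /eqP].
  split; first by have := e 0; rewrite mkseq_cons addn0 => -[].
  apply: eq_mkseqP => n; have := e n; rewrite mkseq_cons => -[_ ->].
  by apply: eq_mkseq => r; rewrite addnS.
pose y := scat (rcons s l0) (scat [:: l1] x).
have ss : size s = m by rewrite size_mkseq.
have ey n : mkseq y (m.+1 + n) = s ++ l0 :: mkseq (scat [:: l1] x) n.
  have -> : m.+1 = size (rcons s l0) by rewrite size_rcons ss.
  by rewrite mkseq_scat cat_rcons.
have ym : y m = l0.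
  by rewrite /y scat_l ?size_rcons ?ss // nth_rcons ss ltnn eqxx.
(* Let [q0] begin [f] and [q1] begin [w]. If [q] is shorter than [s], then [q1] begins [y] too; if
   [q = s], the bound on continuations of [s0] applies. *)
have ley f : factor w f -> f <> mkseq w (size f) -> f <=L mkseq y (size f).
  move=> ff ne; have := wmax f ff; rewrite le_eqVlt => /orP[/eqP//|lt].
  have [|q [a [b [u [v [/letter_lt[ea eb] ef ew ev]]]]]] := lex_split _ lt.
    by rewrite size_mkseq.
  have eq : rcons q l1 = mkseq w (size q).+1.
    have := congr1 (take (size q).+1) ew; rewrite eb -cat_rcons take_size_cat ?size_rcons //.
    by move=> <-; rewrite take_mkseq // ef size_cat /=; lia.
  have [eq' wq] : q = mkseq w (size q) /\ w (size q) = l1.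
    by move: eq; rewrite mkseqS => /rcons_inj[].
  have qm : size q <= m.
    apply: maxm; apply/asbP; split=> //; rewrite -eq'.
    by move: ff; rewrite ef ea -cat_rcons; apply: factor_catl.
  rewrite leq_eqVlt in qm; case/orP: qm => [/eqP qm|qm].
    have eqs : q = s by rewrite eq' qm.
    have sf : size f = m.+1 + size u by rewrite ef size_cat /= qm addnS.
    rewrite sf ey ef eqs ea lex_cat lex_cons ltnn eqxx /=.
    by apply: x3; rewrite -eqs -ea -ef.
  have [n en] : exists n, size f = (size q).+1 + n.
    by exists (size u); rewrite ef size_cat /= addnS.
  have : mkseq y (size q).+1 = rcons q l1.
    rewrite eq -(take_mkseq y (_ : _ <= m.+1 + 0)); last by lia.
    by rewrite ey takel_cat ?ss // take_mkseq.
  rewrite en mkseq_add => ->; rewrite ef ea cat_rcons.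
  exact/ltW/lex_lt_split.
have ley' z n : language_limit w z -> mkseq z n <> mkseq w n ->
    forall r, mkseq z r <=L mkseq y r.
  move=> fz ne r; have h : mkseq z (n + r) <=L mkseq y (n + r).
    have := ley _ (fz (n + r)); rewrite size_mkseq; apply => e; apply: ne.
    by have := congr1 (take n) e; rewrite !take_mkseq // leq_addr.
  by have := lex_take r h; rewrite !take_mkseq // leq_addl.
have ew_ne z : ~ (forall n, mkseq z n = mkseq w n) -> exists n, mkseq z n <> mkseq w n.
  by move=> /not_all_ex_not.
have y2 i : y (m.+2 + i) = x i.
  have -> : m.+2 + i = size (rcons s l0) + (1 + i) by rewrite size_rcons ss; lia.
  by rewrite /y scat_r (scat_r [:: l1]).
(* If [1x] were [w = s10x], then [w] would have period [m.+1] from position 1 on. *)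
have le1 n : mkseq (scat [:: l1] x) n <=L mkseq y n.
  have [|r ner] := ew_ne (scat [:: l1] x).
    move=> /eq_mkseqP e; apply: aper; exists 1, m.+1; split=> // i i1'.
    have ei := e i; rewrite -(subnKC i1') (scat_r [:: l1]) subnKC // in ei.
    by rewrite -ei ex; congr w; lia.
  apply: (ley' _ r) => //; apply/limit_scat1 => i.
  exact: (factor_catr (u := [:: l0]) (z1 i)).
have fy : language_limit w y.
  move=> n; apply: (@factor_catl _ _ _ (mkseq (fun r => y (n + r)) m.+2)).
  rewrite -mkseq_add; have -> : n + m.+2 = m.+1 + n.+1 by lia.
  by rewrite ey mkseq_scat1; apply: x1.
have yw : mkseq y m.+1 <> mkseq w m.+1.
  by rewrite !mkseqS => /rcons_inj[_]; rewrite ym wm.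
have [a fay] := limit_extend_left fy yw.
have fay' := (limit_scat1 _ _ _).1 fay.
case: (letterP a) => ea; rewrite {}ea in fay fay'; last first.
  case: (classic (forall n, mkseq (scat [:: l1] y) n = mkseq w n)).
    move=> /eq_mkseqP e; case: aper; exists m.+2, 1; split=> // i hi.
    have := e (1 + i); rewrite (scat_r [:: l1]) -{1}(subnKC hi) y2 ex.
    by rewrite subnKC // addn1 => ->.
  move=> /ew_ne[n ne]; have h := ley' _ _ fay ne.
  have : mkseq (fun=> l1) m.+1 <=L mkseq y m.+1.
    by apply: nseq_ge => r; have := h r.+1; rewrite mkseq_scat1.
  have : mkseq y m.+1 <=L mkseq (fun=> l1) m.+1.
    by apply: lex_l1_max; rewrite size_mkseq.
  by move=> h1 h2; have := lex_anti h1 h2; rewrite !mkseqS => /rcons_inj[_]; rewrite ym.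
have le2 n : mkseq y n <=L mkseq (scat [:: l1] x) n.
  by have := z3 _ (fay' n); rewrite size_mkseq.
have /eq_mkseqP e : forall n, mkseq y n = mkseq (scat [:: l1] x) n.
  by move=> n; apply: lex_anti.
case: aper; exists m.+2, m.+1; split=> // i hi.
rewrite -{2}(subnKC hi) -ex -y2 e; have -> : m.+2 + (i - m.+2) = 1 + (i - 1) by lia.
by rewrite (scat_r [:: l1]) ex; congr w; lia.
Qed.

(** If the supremum [M] extends by 0, the bound on continuations of 0 gives [M <= 1x]. Otherwise it
    does not extend by 1 either, so [M] is [w] itself, without left extension. *)
Lemma factor_le_tail w x : ~ ultimately_periodic w -> (forall d, exists n, w n = d) ->
  common_tail w x -> forall t, factor w t -> t <=L mkseq (scat [:: l1] x) (size t).
Proof.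
move=> aper hw hx t ft.
have fl d : factor w [:: d] by case: (hw d) => n <-; apply: factor_letter.
have [M [fM sM]] := ex_sup (factor_nil w); rewrite /= in fM sM.
have [z1 z2 z3 z4] := hx [::] (fl _) (fl _).
case: (classic (forall n, factor w (l0 :: mkseq M n))) => h0.
  by apply: (lex_trans (sM t ft)); have := z3 _ (h0 (size t)); rewrite size_mkseq.
have [n0 hn0] := not_all_ex_not _ _ h0.
have [n1 hn1] : exists n, ~ factor w (l1 :: mkseq M n).
  by apply: not_all_ex_not => h; apply: h0; apply: factor_l0_max.
have eM : M =1 w.
  apply: eq_mkseqP => n; apply: NNPP => ne.
  have [a /limit_scat1 fa] := limit_extend_left fM ne.
  by case: (letterP a) fa => -> fa; [apply: hn0|apply: hn1].
apply: (@factor_le_tail_maximal w x aper hx (fl _) _ (n0 + n1)) => // [u fu|a fa].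
  by rewrite -(eq_mkseq eM); apply: sM.
case: (letterP a) fa => ->; rewrite -(eq_mkseq eM) => fa.
  by apply: hn0; apply: (@factor_mkseq_le _ [:: l0] _ _ _ (leq_addr n1 n0)).
by apply: hn1; apply: (@factor_mkseq_le _ [:: l1] _ _ _ (leq_addl n0 n1)).
Qed.

Lemma NFOp_sturmian w : NFOp_i w -> (forall d, exists n, w n = d) -> sturmian w.
Proof.
move=> nf hw; have aper := NFOp_aperiodic nf hw; split=> //.
have [x hx] := NFOp_common_tail nf hw.
apply: balancedI => u f0 f1.
have le1 : rcons u l1 <=L mkseq x (size u).+1.
  have := factor_le_tail aper hw hx f1.
  by rewrite /= size_rcons mkseq_scat1 lex_cons ltnn eqxx.
(* The same bound for the complemented word, read back as [0x <= 0u0]. *)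
have le0 : mkseq x (size u).+1 <=L rcons u l0.
  have := @factor_le_tail (complw w) (complw x) _ _ (common_tail_compl hx) _ (factor_compl f0).
  rewrite -[compl _ <=L _]lex_compl; last by rewrite size_mkseq.
  rewrite complK compl_mkseq_scat1 compl_l1 (eq_mkseq (f := scat _ _) (g := scat [:: l0] x)); last first.
    by move=> i; rewrite /scat; case: ifP => // _; apply: complwK.
  rewrite [size _]size_map /= size_rcons mkseq_scat1 lex_cons ltnn eqxx /=; apply.
    move=> /ultimately_periodic_compl [N [p [p0 h]]]; apply: aper.
    by exists N, p; split=> // n hn; have := h n hn; rewrite !complwK.
  by move=> d; have [n e] := hw (rev_ord d); exists n; rewrite /complw e rev_ordK.
have := lex_trans le1 le0.
by rewrite -!cats1 lex_cat lex_cons.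
Qed.

End Binary.

(** * Equivalence with the three forms of the NFOp *)

Theorem theorem3p9 (k : nat) (w : nat -> 'I_k.+1)
    (hk : 1 <= k) (hw : forall a : 'I_k.+1, exists n : nat, w n = a) :
  [/\ sturmian w <-> NFOp_i w,
      sturmian w <-> NFOp_ii w
    & sturmian w <-> NFOp_iii w].
Proof.
(* The implications form a cycle: (i), Sturmian, (iii), (ii), (i). *)
have i_st : NFOp_i w -> sturmian w.
  move=> nf; have k1 : k = 1 by have := NFOp_binary nf hw; lia.
  by move: w hw nf; rewrite k1 => *; apply: NFOp_sturmian.
have st_iii : sturmian w -> NFOp_iii w.
  (* The letter [k] occurs in [w], whose letters are all below 2. *)
  move=> [w2 aper bal]; have k1 : k = 1.
    by have [n wn] := hw ord_max; have := w2 n; rewrite wn /=; lia.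
  split=> // v v' hs; move: w v v' hw {i_st} w2 aper bal hs; rewrite k1 => {}w v v' _ _ aper bal.
  have -> : inord 1 = ord_max :> 'I_2 by apply: val_inj; rewrite /= inordK.
  exact: sturmian_succ.
have iii_ii : NFOp_iii w -> NFOp_ii w.
  move=> [k1 h] v v' /h[l [m e]]; exists ord0, (inord 1), l, m.
  by split=> //; rewrite inordK // k1.
have ii_i : NFOp_ii w -> NFOp_i w.
  by move=> h v v' /h[a [b [l [m [ab e]]]]]; exists a, b, l, m; rewrite ab.
by split; split; auto.
Qed.
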